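(* Let $N\ge2$ and $n,d\ge1$ be integers, let $0<\mu\le L$ and $\sigma,B,D,\lambda>0$. Put $\chi=\mu/L$, $y^0_*=L\mu nND^2/\sigma^2$, $T=\max\left(-\frac{\ln(y^0_* )}{\ln(1-\chi/2)},1\right)$, $\rho=\frac{n}{T\sigma^2}$ and $$\kappa=\frac{16\sqrt{2e\,\ln(1.25\,Tn^2)\,\ln(4n^2)\,T}\;B}{n}.$$ Consider the problem of maximizing over a common noise level $\alpha\in(0,\infty)$ the common utility $$u(\alpha)=-\frac{\kappa^2}{\alpha^2}-\frac{\lambda}{L\mu N\beta},\quad \beta=\frac{1}{1/\rho+d\alpha^2},\qquad\text{subject to}\qquad u(\alpha)\ge u^0=-\frac{\lambda}{L\mu\rho}.$$ (1) If $\sqrt{(N-1)\lambda}<\sqrt{\frac{4NL\mu d}{N-1}}\,\kappa\rho$, collaboration is unprofitable: no $\alpha\in(0,\infty)$ satisfies $u(\alpha)\ge u^0$. (2) If $\sqrt{(N-1)\lambda}\ge\sqrt{\frac{4NL\mu d}{N-1}}\,\kappa\rho$, collaboration is profitable (the constraint is feasible) and the optimal noise level $\alpha^*$ is given by $$(\alpha^* )^2=\frac{\sqrt{L\mu N}\,\kappa}{\sqrt{\lambda d}}.$$ In this case the optimal noise level satisfies $$\frac{d(\alpha^* )^2}{d\lambda}\le0,\qquad\frac{d(\alpha^* )^2}{d\sigma^2}\le0,\qquad\frac{d(\alpha^* )^2}{dN}\ge0$$ (where $\kappa$ depends on $\sigma^2$ and $N$ through $T$, $N$ is treated as a real variable,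 all other primitive parameters among $n,d,\mu,L,\sigma^2,B,D,\lambda,N$ are held fixed, and the derivatives are taken at points where they exist), and $$u(\alpha^* )-u^0=\frac{\sqrt{(N-1)\lambda}}{L\mu\rho N}\left(\sqrt{(N-1)\lambda}-\sqrt{\frac{4NL\mu d}{N-1}}\,\kappa\rho\right).$$
   Context: Setting (symmetric differentially private stochastic optimization). $N$ clients with $n$ data points each minimize an $L$-smooth, $\mu$-strongly convex objective in dimension $d$ over a closed convex set of diameter at most $D$, with stochastic gradients of variance at most $\sigma^2$ and deviation from the true gradient at most $B/2$; each client adds $N(0,\alpha^2I)$ noise to each batch gradient, with common $\alpha$ and common accuracy weight $\lambda$. There are $T$ rounds with batch size $n/T$ (integrality ignored). The privacy loss is $\mathrm{Leak}=\kappa/\alpha$, the squared accuracy loss is $\mathrm{Err}^2=\frac{1}{L\mu N\beta}$, the utility is $u=-\mathrm{Leak}^2-\lambda\,\mathrm{Err}^2$, and $u^0$ is the utility of training alone. *)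

(* Defs.v *)
From Stdlib Require Import Reals.
From Coquelicot Require Import Coquelicot.
Open Scope R_scope.

(* Every quantity takes the variance bound [sigma2] (sigma squared) and a real
   number of clients [N], because the comparative statics differentiate with
   respect to these two variables. *)

Definition y0star (N : R) (n : nat) (mu L sigma2 D : R) : R :=
  L * mu * INR n * N * D ^ 2 / sigma2.

(* Integrality of the number of rounds is ignored, so this is a real number.
   For 0 < mu <= L the logarithm in the denominator is negative. *)
Definition rounds (N : R) (n : nat) (mu L sigma2 D : R) : R :=
  let chi := mu / L in
  Rmax (- (ln (y0star N n mu L sigma2 D) / ln (1 - chi / 2))) 1.

Definition rho (N : R) (n : nat) (mu L sigma2 D : R) : R :=
  INR n / (rounds N n mu L sigma2 D * sigma2).

Definition kappa (N : R) (n : nat) (mu L sigma2 B D : R) : R :=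
  let T := rounds N n mu L sigma2 D in
  16 * sqrt (2 * exp 1 * ln (1.25 * T * INR n ^ 2) * ln (4 * INR n ^ 2) * T) * B
  / INR n.

Definition beta (N : R) (n d : nat) (mu L sigma2 D alpha : R) : R :=
  1 / (1 / rho N n mu L sigma2 D + INR d * alpha ^ 2).

Definition utility (N : R) (n d : nat) (mu L sigma2 B D lambda alpha : R) : R :=
  - (kappa N n mu L sigma2 B D ^ 2 / alpha ^ 2)
  - lambda / (L * mu * N * beta N n d mu L sigma2 D alpha).

Definition utilityAlone (N : R) (n : nat) (mu L sigma2 D lambda : R) : R :=
  - (lambda / (L * mu * rho N n mu L sigma2 D)).

Definition feasible (N : R) (n d : nat) (mu L sigma2 B D lambda alpha : R) : Prop :=
  0 < alpha /\
  utility N n d mu L sigma2 B D lambda alpha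
    >= utilityAlone N n mu L sigma2 D lambda.

Definition profitable (N : R) (n d : nat) (mu L sigma2 B D lambda : R) : Prop :=
  exists alpha : R, feasible N n d mu L sigma2 B D lambda alpha.

Definition optimalNoise (N : R) (n d : nat) (mu L sigma2 B D lambda alpha : R) : Prop :=
  feasible N n d mu L sigma2 B D lambda alpha /\
  forall alpha' : R, feasible N n d mu L sigma2 B D lambda alpha' ->
    utility N n d mu L sigma2 B D lambda alpha'
      <= utility N n d mu L sigma2 B D lambda alpha.

Definition alphaStarSq (N : R) (n d : nat) (mu L sigma2 B D lambda : R) : R :=
  sqrt (L * mu * N) * kappa N n mu L sigma2 B D / sqrt (lambda * INR d).

(* Main.v *)
Require Import Defs.
From Stdlib Require Import Reals Lra.
From Coquelicot Require Import Coquelicot.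
Open Scope R_scope.

(** Completing the square: the excess of [u(alpha)] over [u0] is its maximal
    value [gain * (gain - cost) / (L mu rho N)] minus
    [(kappa / alpha - s alpha)^2] with [s = sqrt (lambda d) / sqrt (L mu N)].
    Hence the maximizer is [alpha^2 = kappa / s], and the constraint is feasible
    exactly when the maximal value is nonnegative. For the comparative statics,
    [kappa] is nondecreasing in the number of rounds [T], which is itself
    nonincreasing in [sigma^2] and nondecreasing in [N]. *)

(** Only points to the right of [x] are compared, so when [x] is a positive parameter every
    comparison point is positive as well. *)
Lemma Derive_nonpos_of_decreasing (f : R -> R) (x : R) :
  (forall y, x < y -> f y <= f x) -> ex_derive f x -> Derive f x <= 0.
Proof.
  intros Hf Hd.
  destruct (Rle_or_lt (Derive f x) 0) as [H|H]; [exact H|exfalso].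
  apply Derive_correct, is_derive_Reals in Hd.
  (* The derivative, assumed positive, serves as its own tolerance: at increment [del / 2] the
     difference quotient would then be strictly positive. *)
  destruct (Hd (Derive f x) H) as [del Hdel].
  pose proof (cond_pos del) as Hp.
  assert (Hh : del / 2 <> 0) by lra.
  assert (Habs : Rabs (del / 2) < del) by (rewrite Rabs_pos_eq; lra).
  specialize (Hdel _ Hh Habs).
  apply Rabs_def2 in Hdel.
  assert (Hq : (f (x + del / 2) - f x) / (del / 2) <= 0).
  { assert (f (x + del / 2) <= f x) by (apply Hf; lra).
    assert (0 < / (del / 2)) by (apply Rinv_0_lt_compat; lra).
    unfold Rdiv at 1; nra. }
  lra.
Qed.

Lemma Derive_nonneg_of_increasing (f : R -> R) (x : R) :
  (forall y, x < y -> f x <= f y) -> ex_derive f x -> 0 <= Derive f x.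
Proof.
  intros Hf Hd.
  assert (H : Derive (fun y => - f y) x <= 0).
  { apply Derive_nonpos_of_decreasing.
    - intros y Hy; apply Ropp_le_contravar, Hf, Hy.
    - exact (ex_derive_opp f x Hd). }
  rewrite Derive_opp in H; lra.
Qed.

(** * Monotonicity of the number of rounds *)

Lemma INR_ge_1 (n : nat) : (1 <= n)%nat -> 1 <= INR n.
Proof. intros H; apply (le_INR 1 n H). Qed.

Lemma rounds_ge_1 (N : R) (n : nat) (mu L sigma2 D : R) :
  1 <= rounds N n mu L sigma2 D.
Proof. apply Rmax_r. Qed.

Lemma ln_contraction_neg (mu L : R) :
  0 < mu -> mu <= L -> ln (1 - mu / L / 2) < 0.
Proof.
  intros Hmu HL.
  assert (0 < mu / L) by (apply Rdiv_lt_0_compat; lra).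
  assert (mu / L <= 1) by (apply Rle_div_l; lra).
  rewrite <- ln_1; apply ln_increasing; lra.
Qed.

Lemma y0star_pos (N : R) (n : nat) (mu L sigma2 D : R) :
  0 < N -> (1 <= n)%nat -> 0 < mu -> 0 < L -> 0 < sigma2 -> 0 < D ->
  0 < y0star N n mu L sigma2 D.
Proof.
  intros HN Hn%INR_ge_1 Hmu HL Hs HD; unfold y0star.
  apply Rdiv_lt_0_compat; [|exact Hs].
  repeat apply Rmult_lt_0_compat; try apply pow_lt; lra.
Qed.

(** [N] and [sigma2] enter [rounds] only through [y0star]. Dividing by the negative logarithm and
    negating preserves the order of the logarithms, and so does the truncation at 1. *)
Lemma rounds_le_of_y0star_le (N N' : R) (n : nat) (mu L sigma2 sigma2' D : R) :
  0 < mu -> mu <= L -> 0 < y0star N n mu L sigma2 D ->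
  y0star N n mu L sigma2 D <= y0star N' n mu L sigma2' D ->
  rounds N n mu L sigma2 D <= rounds N' n mu L sigma2' D.
Proof.
  intros Hmu HL Hy Hle; unfold rounds.
  apply Rle_max_compat_r.
  pose proof (ln_contraction_neg mu L Hmu HL) as Hln.
  apply (ln_le _ _ Hy) in Hle.
  apply Rinv_lt_0_compat in Hln.
  (* Only the two outer quotients are unfolded, so that the inverse of the logarithm keeps the form
     it has in [Hln]. *)
  unfold Rdiv at 1 4; nra.
Qed.

Lemma rounds_decreasing_sigma2 (N : R) (n : nat) (mu L s s' D : R) :
  0 < N -> (1 <= n)%nat -> 0 < mu -> mu <= L -> 0 < D -> 0 < s -> s <= s' ->
  rounds N n mu L s' D <= rounds N n mu L s D.
Proof.
  intros HN Hn Hmu HL HD Hs Hss.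
  apply rounds_le_of_y0star_le; try assumption.
  - apply y0star_pos; lra || assumption.
  - apply INR_ge_1 in Hn; unfold y0star, Rdiv.
    apply Rmult_le_compat_l; [|apply Rinv_le_contravar; lra].
    repeat apply Rmult_le_pos; try apply pow_le; lra.
Qed.

Lemma rounds_increasing_N (N N' : R) (n : nat) (mu L sigma2 D : R) :
  0 < N -> (1 <= n)%nat -> 0 < mu -> mu <= L -> 0 < D -> 0 < sigma2 -> N <= N' ->
  rounds N n mu L sigma2 D <= rounds N' n mu L sigma2 D.
Proof.
  intros HN Hn Hmu HL HD Hs HNN.
  apply rounds_le_of_y0star_le; try assumption.
  - apply y0star_pos; lra || assumption.
  - apply INR_ge_1 in Hn; unfold y0star, Rdiv.
    apply Rmult_le_compat_r; [left; apply Rinv_0_lt_compat; lra|].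
    apply Rmult_le_compat_r; [apply pow_le; lra|].
    apply Rmult_le_compat_l; [|lra].
    repeat apply Rmult_le_pos; lra.
Qed.

(** * Positivity and monotonicity of the privacy constant *)

Lemma ln_4_sq_pos (n : nat) : (1 <= n)%nat -> 0 < ln (4 * INR n ^ 2).
Proof.
  intros Hn%INR_ge_1; rewrite <- ln_1; apply ln_increasing; nra.
Qed.

Lemma ln_privacy_pos (n : nat) (T : R) :
  (1 <= n)%nat -> 1 <= T -> 0 < ln (1.25 * T * INR n ^ 2).
Proof.
  intros Hn%INR_ge_1 HT; rewrite <- ln_1; apply ln_increasing; [lra|].
  assert (1 <= INR n ^ 2) by nra; nra.
Qed.

Lemma kappa_pos (N : R) (n : nat) (mu L sigma2 B D : R) :
  (1 <= n)%nat -> 0 < B -> 0 < kappa N n mu L sigma2 B D.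
Proof.
  intros Hn HB; unfold kappa.
  pose proof (rounds_ge_1 N n mu L sigma2 D) as HT.
  pose proof (ln_4_sq_pos n Hn) as H4.
  pose proof (ln_privacy_pos n _ Hn HT) as Hp.
  pose proof (exp_pos 1).
  apply INR_ge_1 in Hn.
  apply Rdiv_lt_0_compat; [|lra].
  apply Rmult_lt_0_compat; [|exact HB].
  apply Rmult_lt_0_compat; [lra|apply sqrt_lt_R0].
  repeat apply Rmult_lt_0_compat; lra.
Qed.

(** [kappa] sees [N] and [sigma2] only through [T], which occurs under the root in two positive
    nondecreasing factors, [T] and [ln (1.25 * T * INR n ^ 2)]. *)
Lemma kappa_le_of_rounds_le (N N' : R) (n : nat) (mu L sigma2 sigma2' B D : R) :
  (1 <= n)%nat -> 0 < B ->
  rounds N n mu L sigma2 D <= rounds N' n mu L sigma2' D ->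
  kappa N n mu L sigma2 B D <= kappa N' n mu L sigma2' B D.
Proof.
  intros Hn HB Hle; unfold kappa.
  pose proof (rounds_ge_1 N n mu L sigma2 D) as HT.
  pose proof (ln_4_sq_pos n Hn) as H4.
  pose proof (ln_privacy_pos n _ Hn HT) as Hp.
  pose proof (exp_pos 1).
  apply INR_ge_1 in Hn.
  apply Rmult_le_compat_r; [left; apply Rinv_0_lt_compat; lra|].
  apply Rmult_le_compat_r; [lra|].
  apply Rmult_le_compat_l; [lra|].
  apply sqrt_le_1_alt.
  assert (0 < 1.25 * rounds N n mu L sigma2 D * INR n ^ 2)
    by (apply Rmult_lt_0_compat; [lra|apply pow_lt; lra]).
  apply Rmult_le_compat; try lra.
  - left; repeat apply Rmult_lt_0_compat; lra.
  - apply Rmult_le_compat_r; [lra|].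
    apply Rmult_le_compat_l; [lra|].
    apply ln_le; [assumption|].
    apply Rmult_le_compat_r; [apply pow_le; lra|lra].
Qed.

(** * The utility excess as a completed square *)

Lemma rho_pos (N : R) (n : nat) (mu L sigma2 D : R) :
  (1 <= n)%nat -> 0 < sigma2 -> 0 < rho N n mu L sigma2 D.
Proof.
  intros Hn%INR_ge_1 Hs; unfold rho.
  pose proof (rounds_ge_1 N n mu L sigma2 D).
  apply Rdiv_lt_0_compat; [lra|apply Rmult_lt_0_compat; lra].
Qed.

(** The factors [N - 1] cancel under the root. Divided by [L * mu * N * r], the product is the cross
    term of the square in [utility_minus_alone]. *)
Lemma gain_times_cost (N d mu L lambda k r : R) :
  1 < N -> 0 < d -> 0 < mu -> 0 < L -> 0 < lambda ->
  sqrt ((N - 1) * lambda) * (sqrt (4 * N * L * mu * d / (N - 1)) * k * r)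
  = 2 * sqrt (lambda * d) * sqrt (L * mu * N) * k * r.
Proof.
  intros HN Hd Hmu HL Hl.
  assert (HA : 0 < L * mu * N) by (repeat apply Rmult_lt_0_compat; lra).
  assert (HC : 0 < lambda * d) by (apply Rmult_lt_0_compat; lra).
  assert (H : sqrt ((N - 1) * lambda) * sqrt (4 * N * L * mu * d / (N - 1))
              = 2 * sqrt (lambda * d) * sqrt (L * mu * N)).
  { rewrite <- sqrt_mult_alt by (apply Rmult_le_pos; lra).
    replace ((N - 1) * lambda * (4 * N * L * mu * d / (N - 1)))
      with (2 * 2 * ((lambda * d) * (L * mu * N))) by (field; lra).
    rewrite sqrt_mult_alt by lra.
    rewrite sqrt_square by lra.
    rewrite sqrt_mult_alt by lra.
    ring. }
  rewrite <- !Rmult_assoc, H; ring.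
Qed.

(** Since [1 / beta] is [1 / r + d alpha^2], the excess is [(N - 1) lambda / (L mu N r)] minus
    [k^2 / alpha^2] and [lambda d alpha^2 / (L mu N)]. The first term is [gain^2 / (L mu N r)], and
    the other two are the squares to be completed. *)
Lemma utility_minus_alone (N : R) (n d : nat) (mu L sigma2 B D lambda alpha : R) :
  1 < N -> (1 <= n)%nat -> (1 <= d)%nat -> 0 < mu -> 0 < L -> 0 < sigma2 ->
  0 < lambda -> 0 < alpha ->
  let r := rho N n mu L sigma2 D in
  let k := kappa N n mu L sigma2 B D in
  let gain := sqrt ((N - 1) * lambda) in
  let cost := sqrt (4 * N * L * mu * INR d / (N - 1)) * k * r in
  utility N n d mu L sigma2 B D lambda alpha - utilityAlone N n mu L sigma2 D lambda
  = gain / (L * mu * r * N) * (gain - cost)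
    - (k / alpha - sqrt (lambda * INR d) / sqrt (L * mu * N) * alpha) ^ 2.
Proof.
  intros HN Hn Hd Hmu HL Hs Hl Ha r k gain cost.
  assert (Hr : 0 < r) by (apply rho_pos; assumption).
  apply INR_ge_1 in Hd.
  assert (HA : 0 < L * mu * N) by (repeat apply Rmult_lt_0_compat; lra).
  assert (HC : 0 < lambda * INR d) by (apply Rmult_lt_0_compat; lra).
  assert (Hgg : gain * gain = (N - 1) * lambda)
    by (apply sqrt_sqrt, Rmult_le_pos; lra).
  assert (Hgc : gain * cost
                = 2 * sqrt (lambda * INR d) * sqrt (L * mu * N) * k * r)
    by (apply gain_times_cost; lra).
  pose proof (sqrt_lt_R0 _ HA) as Hp.
  pose proof (sqrt_sqrt _ (Rlt_le _ _ HA)) as Hpp.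
  pose proof (sqrt_sqrt _ (Rlt_le _ _ HC)) as Hqq.
  replace (gain / (L * mu * r * N) * (gain - cost))
    with ((gain * gain - gain * cost) / (L * mu * r * N)) by (field; lra).
  rewrite Hgg, Hgc.
  unfold utility, utilityAlone, beta; fold r k; clearbody r k.
  (* With [L * mu * N] written as [p * p] and [lambda * INR d] as [q * q], the claim becomes a
     rational identity in which [p] and [q] are free variables. *)
  set (p := sqrt (L * mu * N)) in *; set (q := sqrt (lambda * INR d)) in *.
  (* Clearing the nested fraction [1 / (1 / r + INR d * alpha ^ 2)] produces this denominator. *)
  assert (Hden : 0 < 1 + INR d * alpha ^ 2 * r).
  { assert (0 < INR d * alpha ^ 2 * r)
      by (repeat apply Rmult_lt_0_compat; lra). lra. }
  replace (lambda / (L * mu * N * (1 / (1 / r + INR d * alpha ^ 2))))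
    with (lambda / (r * (p * p)) + (q * q) * alpha ^ 2 / (p * p))
    by (rewrite Hpp, Hqq; field; repeat split; lra).
  replace (lambda / (L * mu * r)) with (lambda * N / (r * (p * p)))
    by (rewrite Hpp; field; repeat split; lra).
  replace (L * mu * r * N) with (r * (p * p)) by (rewrite Hpp; ring).
  field; repeat split; lra.
Qed.

(** * The balance point of the two losses and its monotonicity *)

Lemma noise_balance_iff (k s alpha : R) :
  0 < s -> 0 < alpha -> k / alpha - s * alpha = 0 <-> alpha ^ 2 = k / s.
Proof.
  intros Hs Ha; split; intros H.
  - replace k with (alpha * (k / alpha)) by (field; lra).
    replace (k / alpha) with (s * alpha) by lra.
    field; lra.
  - replace k with (s * (k / s)) by (field; lra).
    rewrite <- H; field; lra.
Qed.

Lemma alphaStarSq_eq (N : R) (n d : nat) (mu L sigma2 B D lambda : R) :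
  0 < L * mu * N -> 0 < lambda * INR d ->
  alphaStarSq N n d mu L sigma2 B D lambda
  = kappa N n mu L sigma2 B D / (sqrt (lambda * INR d) / sqrt (L * mu * N)).
Proof.
  intros HA%sqrt_lt_R0 HC%sqrt_lt_R0; unfold alphaStarSq; field; lra.
Qed.

Lemma alphaStarSq_decreasing_lambda (N : R) (n d : nat) (mu L sigma2 B D l l' : R) :
  (1 <= n)%nat -> (1 <= d)%nat -> 0 < B -> 0 < l -> l <= l' ->
  alphaStarSq N n d mu L sigma2 B D l' <= alphaStarSq N n d mu L sigma2 B D l.
Proof.
  intros Hn Hd%INR_ge_1 HB Hl Hll; unfold alphaStarSq.
  apply Rmult_le_compat_l.
  - apply Rmult_le_pos; [apply sqrt_pos|left; apply kappa_pos; assumption].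
  - apply Rinv_le_contravar.
    + apply sqrt_lt_R0, Rmult_lt_0_compat; lra.
    + apply sqrt_le_1_alt, Rmult_le_compat_r; lra.
Qed.

Lemma alphaStarSq_decreasing_sigma2 (N : R) (n d : nat) (mu L s s' B D lambda : R) :
  0 < N -> (1 <= n)%nat -> (1 <= d)%nat -> 0 < mu -> mu <= L -> 0 < B -> 0 < D ->
  0 < lambda -> 0 < s -> s <= s' ->
  alphaStarSq N n d mu L s' B D lambda <= alphaStarSq N n d mu L s B D lambda.
Proof.
  intros HN Hn Hd%INR_ge_1 Hmu HL HB HD Hl Hs Hss; unfold alphaStarSq.
  apply Rmult_le_compat_r.
  - left; apply Rinv_0_lt_compat, sqrt_lt_R0, Rmult_lt_0_compat; lra.
  - apply Rmult_le_compat_l; [apply sqrt_pos|].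
    apply kappa_le_of_rounds_le; try assumption.
    apply rounds_decreasing_sigma2; assumption.
Qed.

(** [N] acts twice, through [sqrt (L * mu * N)] and through [kappa], and both nonnegative factors
    grow. *)
Lemma alphaStarSq_increasing_N (N N' : R) (n d : nat) (mu L sigma2 B D lambda : R) :
  0 < N -> (1 <= n)%nat -> (1 <= d)%nat -> 0 < mu -> mu <= L -> 0 < B -> 0 < D ->
  0 < lambda -> 0 < sigma2 -> N <= N' ->
  alphaStarSq N n d mu L sigma2 B D lambda <= alphaStarSq N' n d mu L sigma2 B D lambda.
Proof.
  intros HN Hn Hd%INR_ge_1 Hmu HL HB HD Hl Hs HNN; unfold alphaStarSq.
  apply Rmult_le_compat_r.
  - left; apply Rinv_0_lt_compat, sqrt_lt_R0, Rmult_lt_0_compat; lra.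
  - apply Rmult_le_compat.
    + apply sqrt_pos.
    + left; apply kappa_pos; assumption.
    + apply sqrt_le_1_alt, Rmult_le_compat_l; [apply Rmult_le_pos; lra|exact HNN].
    + apply kappa_le_of_rounds_le; try assumption.
      apply rounds_increasing_N; assumption.
Qed.

Theorem mainTheorem5 (N n d : nat) (mu L sigma B D lambda : R)
  (hN : (2 <= N)%nat) (hn : (1 <= n)%nat) (hd : (1 <= d)%nat)
  (hmu : 0 < mu) (hmuL : mu <= L) (hsigma : 0 < sigma)
  (hB : 0 < B) (hD : 0 < D) (hlambda : 0 < lambda) :
  let u := utility (INR N) n d mu L (sigma ^ 2) B D lambda in
  let u0 := utilityAlone (INR N) n mu L (sigma ^ 2) D lambda in
  let r := rho (INR N) n mu L (sigma ^ 2) D in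
  let k := kappa (INR N) n mu L (sigma ^ 2) B D in
  let gain := sqrt ((INR N - 1) * lambda) in
  let cost := sqrt (4 * INR N * L * mu * INR d / (INR N - 1)) * k * r in
  (gain < cost -> ~ profitable (INR N) n d mu L (sigma ^ 2) B D lambda) /\
  (gain >= cost ->
    profitable (INR N) n d mu L (sigma ^ 2) B D lambda /\
    (exists! alpha : R,
       optimalNoise (INR N) n d mu L (sigma ^ 2) B D lambda alpha) /\
    (forall alpha : R,
       optimalNoise (INR N) n d mu L (sigma ^ 2) B D lambda alpha ->
       alpha ^ 2 = alphaStarSq (INR N) n d mu L (sigma ^ 2) B D lambda /\
       u alpha - u0 = gain / (L * mu * r * INR N) * (gain - cost)) /\
    (ex_derive (fun l : R => alphaStarSq (INR N) n d mu L (sigma ^ 2) B D l) lambda ->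
     Derive (fun l : R => alphaStarSq (INR N) n d mu L (sigma ^ 2) B D l) lambda <= 0) /\
    (ex_derive (fun s : R => alphaStarSq (INR N) n d mu L s B D lambda) (sigma ^ 2) ->
     Derive (fun s : R => alphaStarSq (INR N) n d mu L s B D lambda) (sigma ^ 2) <= 0) /\
    (ex_derive (fun x : R => alphaStarSq x n d mu L (sigma ^ 2) B D lambda) (INR N) ->
     Derive (fun x : R => alphaStarSq x n d mu L (sigma ^ 2) B D lambda) (INR N) >= 0)).
Proof.
  intros u u0 r k gain cost.
  assert (HN : 1 < INR N).
  { apply (lt_INR 1 N hN). }
  assert (Hs2 : 0 < sigma ^ 2) by (apply pow_lt; exact hsigma).
  assert (HL : 0 < L) by lra.
  assert (Hr : 0 < r) by (apply rho_pos; assumption).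
  assert (Hk : 0 < k) by (apply kappa_pos; assumption).
  pose proof (INR_ge_1 d hd) as Hd1.
  assert (HA : 0 < L * mu * INR N) by (repeat apply Rmult_lt_0_compat; lra).
  assert (HC : 0 < lambda * INR d) by (apply Rmult_lt_0_compat; lra).
  pose proof (sqrt_lt_R0 _ HA) as Hp.
  pose proof (sqrt_lt_R0 _ HC) as Hq.
  assert (Hg : 0 < gain) by (apply sqrt_lt_R0, Rmult_lt_0_compat; lra).
  set (s := sqrt (lambda * INR d) / sqrt (L * mu * INR N)).
  assert (Hs : 0 < s) by (apply Rdiv_lt_0_compat; lra).
  assert (Hc : 0 < gain / (L * mu * r * INR N))
    by (apply Rdiv_lt_0_compat; [exact Hg|];
        replace (L * mu * r * INR N) with (L * mu * INR N * r) by ring;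
        apply Rmult_lt_0_compat; assumption).
  (* The excess where the square vanishes; its sign is that of [gain - cost], because the prefactor
     is positive. *)
  set (best := gain / (L * mu * r * INR N) * (gain - cost)).
  assert (Hu : forall alpha, 0 < alpha ->
            u alpha - u0 = best - (k / alpha - s * alpha) ^ 2).
  { intros alpha Ha; apply utility_minus_alone; assumption. }
  assert (Hstar : alphaStarSq (INR N) n d mu L (sigma ^ 2) B D lambda = k / s)
    by (apply alphaStarSq_eq; assumption).
  split.
  - intros Hlt [alpha [Ha Hf]].
    change (u alpha >= u0) in Hf.
    specialize (Hu alpha Ha).
    pose proof (pow2_ge_0 (k / alpha - s * alpha)).
    assert (best < 0) by (unfold best; nra).
    lra.
  - intros Hge.
    assert (Hbest : 0 <= best) by (unfold best; nra).
    (* The positive root of the balance equation, where the subtracted square is zero. *)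
    set (a := sqrt (k / s)).
    assert (Hks : 0 < k / s) by (apply Rdiv_lt_0_compat; lra).
    assert (Ha : 0 < a) by (apply sqrt_lt_R0; exact Hks).
    assert (Ha2 : a ^ 2 = k / s) by (apply pow2_sqrt; lra).
    assert (Hua : u a - u0 = best).
    { rewrite (Hu a Ha), (proj2 (noise_balance_iff k s a Hs Ha) Ha2); ring. }
    assert (Hfa : feasible (INR N) n d mu L (sigma ^ 2) B D lambda a).
    { split; [exact Ha|]. change (u a >= u0). lra. }
    (* Any maximizer does at least as well as [a], whose excess is [best], so its own subtracted
       square must be zero. *)
    assert (Hopt : forall alpha,
              optimalNoise (INR N) n d mu L (sigma ^ 2) B D lambda alpha ->
              0 < alpha /\ alpha ^ 2 = k / s /\ u alpha - u0 = best).
    { intros alpha [[Hal _] Hmax].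
      specialize (Hmax a Hfa); change (u a <= u alpha) in Hmax.
      pose proof (Hu alpha Hal) as Hual.
      pose proof (pow2_ge_0 (k / alpha - s * alpha)).
      assert (Hz : (k / alpha - s * alpha) ^ 2 = 0) by lra.
      repeat split; [exact Hal| |lra].
      apply noise_balance_iff; [exact Hs|exact Hal|].
      apply Rsqr_0_uniq; rewrite Rsqr_pow2; exact Hz. }
    split; [|split; [|split; [|split; [|split]]]].
    + exists a; exact Hfa.
    + exists a; split.
      * split; [exact Hfa|].
        intros alpha [Hal _]; change (u alpha <= u a).
        pose proof (Hu alpha Hal).
        pose proof (pow2_ge_0 (k / alpha - s * alpha)); lra.
      (* Uniqueness: a positive noise level is determined by its square. *)
      * intros alpha Hal; destruct (Hopt alpha Hal) as [Hal0 [Hal2 _]].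
        unfold a; rewrite <- Hal2; apply sqrt_pow2; lra.
    + intros alpha Hal; destruct (Hopt alpha Hal) as [_ [Hal2 Hual]].
      split; [rewrite Hstar; exact Hal2|exact Hual].
    + apply Derive_nonpos_of_decreasing; intros l Hl.
      apply alphaStarSq_decreasing_lambda; lra || assumption.
    + apply Derive_nonpos_of_decreasing; intros s' Hs'.
      apply alphaStarSq_decreasing_sigma2; lra || assumption.
    + intros Hex; apply Rle_ge; revert Hex.
      apply Derive_nonneg_of_increasing; intros x Hx.
      apply alphaStarSq_increasing_N; lra || assumption.
Qed.
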